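(* For every graph $G$, if $d:=2\lceil 17 \log_2 \pi(G)\rceil+1$ then $\pi(G^{(d)})\leq 5$.
   Context: All graphs are finite, simple and undirected. A path in a graph is a sequence of pairwise distinct vertices, consecutive ones adjacent. Given a vertex colouring $\phi$, a sequence $(v_1,\dots,v_{2s})$ is repetitively coloured if $\phi(v_i)=\phi(v_{s+i})$ for all $i\in\{1,\dots,s\}$; a colouring is nonrepetitive if no path is repetitively coloured. $\pi(G)$ is the minimum number of colours in a nonrepetitive colouring of $G$. For an integer $d\ge 0$, $G^{(d)}$ denotes the $d$-subdivision of $G$: each edge $vw$ is replaced by a path from $v$ to $w$ with exactly $d$ internal vertices, these paths being internally disjoint. *)

(* Defs.v *)
From mathcomp Require Import all_boot all_order all_algebra.
From mathcomp Require Import boolp reals exp.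

Set Implicit Arguments.
Unset Strict Implicit.
Unset Printing Implicit Defensive.

Record sgraph := SGraph {
  vertex :> finType;
  adj : rel vertex;
  adj_sym : symmetric adj;
  adj_irr : irreflexive adj }.

Definition is_path (G : sgraph) (s : seq G) : bool :=
  uniq s && sorted (@adj G) s.

(* The empty sequence is not repetitively coloured; [x0] is the dummy default
   of [nth], all indices used being in range. *)
Definition repetitively_coloured (G : sgraph) (C : Type) (phi : G -> C)
    (s : seq G) : Prop :=
  exists k : nat, [/\ 0 < k, size s = 2 * k &
    forall (x0 : G) (i : nat), i < k -> phi (nth x0 s i) = phi (nth x0 s (k + i))].

Definition nonrepetitive (G : sgraph) (C : Type) (phi : G -> C) : Prop :=
  forall s : seq G, is_path s -> ~ repetitively_coloured phi s.

Definition nonrepetitively_colourable (G : sgraph) (c : nat) : Prop :=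
  exists phi : G -> 'I_c, nonrepetitive phi.

Lemma nonrepetitively_colourable_ex (G : sgraph) :
  exists c : nat, `[< nonrepetitively_colourable G c >].
Proof.
exists #|G|; apply/asboolP; exists enum_rank => s /andP[us _] [k [k0 sk H]].
case: s us sk H => [_ /esym/eqP|x s us sk /(_ x 0 k0)].
  by rewrite muln_eq0 /= eqn0Ngt k0.
rewrite addn0 => /enum_rank_inj/eqP.
have lt_k2 : k < 2 * k by rewrite -[X in X < _]mul1n ltn_pmul2r.
by rewrite nth_uniq ?sk ?muln_gt0 // eq_sym eqn0Ngt k0.
Qed.

Definition nonrep_number (G : sgraph) : nat :=
  ex_minn (nonrepetitively_colourable_ex G).

Section Subdivision.
Variables (G : sgraph) (d : nat).

(* Each edge uv appears once, as the pair oriented along [enum_rank]. *)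
Definition oriented_edge : finType :=
  {p : G * G | adj p.1 p.2 && (enum_rank p.1 < enum_rank p.2)}.

(* [inr (p, i)] is the i-th internal vertex, counted from [(val p).1], of the
   path replacing the edge [p]. *)
Definition subdiv_vertex : finType := (G + oriented_edge * 'I_d)%type.

Definition subdiv_end (v : G) (q : oriented_edge * 'I_d) : bool :=
  ((v == (val q.1).1) && (q.2 == 0 :> nat)) ||
  ((v == (val q.1).2) && (q.2.+1 == d)).

Definition subdiv_adj : rel subdiv_vertex := fun x y =>
  match x, y with
  | inl u, inl v => (d == 0) && adj u v
  | inl v, inr q | inr q, inl v => subdiv_end v q
  | inr q, inr r =>
      (q.1 == r.1) && ((q.2.+1 == r.2 :> nat) || (r.2.+1 == q.2 :> nat))
  end.

Lemma subdiv_adj_sym : symmetric subdiv_adj.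
Proof.
by move=> [u|q] [v|r] //=; rewrite ?(adj_sym u) // (eq_sym q.1) orbC.
Qed.

Lemma subdiv_adj_irr : irreflexive subdiv_adj.
Proof.
move=> [u|q] /=; first by rewrite adj_irr andbF.
by rewrite eqxx orbb -[X in _ == X]addn0 -addn1 eqn_add2l.
Qed.

Definition subdivision : sgraph := SGraph subdiv_adj_sym subdiv_adj_irr.

End Subdivision.

Definition log2 (R : realType) (x : R) : R := (ln x / ln 2)%R.

(* Main.v *)
Require Import Defs.
From mathcomp Require Import all_boot all_order all_algebra zify.
From mathcomp Require Import boolp reals exp.

Set Implicit Arguments.
Unset Strict Implicit.
Unset Printing Implicit Defensive.

Import Order.TTheory GRing.Theory Num.Theory.

(** The original vertices get a colour of their own, which leaves four letters
    for the division vertices.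

    Squarefree words over four letters at least double in number with each
    letter added: an extension of a squarefree word by one letter fails only if
    it begins with a square [uu], and it is then determined by what follows the
    first [u], so with [a(i)] words of length [i] we have
    [4 a(n) <= a(n+1) + a(n) + a(n-1) + ... + a(0)].  Let [c] be the
    nonrepetitive chromatic number of [G] and [d = 2n+1].  Since
    [c^17 <= 2^n], there is room to choose greedily [c^2] squarefree words of
    length [d] such that all their prefixes of length [n+1] and all the prefixes
    of length [n+1] of their reversals are distinct.  Given an optimal colouring
    [phi] of [G], the path replacing an edge from [u] to [v] is coloured by the
    word indexed by [(phi u, phi v)].

    A repetitively coloured path that contains no original vertex is a square
    inside a word.  Otherwise its half-length is a multiple [m(d+1)] and its
    original vertices [v_1, ..., v_2m] are regularly spaced.  Up to reversing
    the path, each of them is followed by at least [n+1] division vertices,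
    whose colours determine that of [v_i] under [phi]; so [v_1, ..., v_2m]
    would be repetitively coloured by [phi]. *)

(** * Squarefree words *)

Lemma count_le_inj (A B : eqType) (f : A -> B) (p : pred A) s t : uniq s ->
  {in s, forall x, p x -> f x \in t} ->
  {in s &, forall x y, p x -> p y -> f x = f y -> x = y} ->
  count p s <= size t.
Proof.
move=> us sub inj; rewrite -size_filter -(size_map f); apply: uniq_leq_size.
  rewrite map_inj_in_uniq ?filter_uniq // => x y.
  by rewrite !mem_filter => /andP[px xs] /andP[py ys]; apply: inj.
by move=> _ /mapP[x + ->]; rewrite mem_filter => /andP[px xs]; apply: sub.
Qed.

Lemma count_has_le (A B : Type) (p : B -> pred A) (r : seq B) (s : seq A) :
  count (fun x => has (p^~ x) r) s <= \sum_(k <- r) count (p k) s.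
Proof.
elim: r => [|k r IH]; first by rewrite big_nil; elim: s.
rewrite big_cons (leq_trans _ (leq_add (leqnn _) IH)) //.
rewrite -(count_predUI (p k) (fun x => has (p^~ x) r)).
exact: (leq_trans _ (leq_addr _ _)).
Qed.

Section SquarefreeWords.
Variable T : eqType.
Implicit Types w : seq T.

Definition square_prefix w :=
  has (fun k => take k w == take k (drop k w)) (iota 1 (size w)./2).

(** Recursion on suffixes: a letter added in front of a squarefree word then calls for a single
    test, [square_prefix]. *)
Fixpoint squarefree w :=
  if w is _ :: w' then ~~ square_prefix w && squarefree w' else true.

Lemma squarefreeP w :
  reflect (forall i k, 0 < k -> i + k.*2 <= size w ->
             take k (drop i w) <> take k (drop (i + k) w))
          (squarefree w).
Proof.
elim: w => [|x w IH] /=.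
  by constructor=> i k; case: k => // k _; rewrite doubleS addnS.
apply: (iffP andP) => [[npre /IH sf] [|i] k k0 le_k|sf].
- rewrite drop0 => eq_k; move/hasPn: npre => /(_ k); rewrite mem_iota k0 /=.
  by rewrite -eq_k eqxx => /(_ _)/negP; apply=> //; lia.
- by rewrite addSn /=; apply: sf => //; lia.
split.
  apply/hasPn => k; rewrite mem_iota => /andP[k0 lek].
  apply/negP => /eqP eq_k; apply: (sf 0 k); rewrite ?drop0 //.
  by move: lek => /=; lia.
apply/IH => i k k0 lek; have := sf i.+1 k k0; rewrite addSn /=; apply.
by move: lek; lia.
Qed.

Lemma squarefree_nth x0 w i k : squarefree w -> 0 < k -> i + k.*2 <= size w ->
  ~ (forall t, t < k -> nth x0 w (i + t) = nth x0 w (i + k + t)).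
Proof.
move=> /squarefreeP sf k0 lek eq_nth; apply: (sf i k k0 lek).
apply: (@eq_from_nth _ x0) => [|t]; rewrite !size_takel ?size_drop ?leq_subRL;
  try lia.
by move=> ltk; rewrite !nth_take // !nth_drop eq_nth.
Qed.

Lemma squarefree_drop i w : squarefree w -> squarefree (drop i w).
Proof.
by elim: w i => [|x w IH] [|i] //= /andP[_ sf]; apply: IH.
Qed.

Lemma squarefree_rev w : squarefree (rev w) = squarefree w.
Proof.
suff sub u : squarefree u -> squarefree (rev u).
  by apply/idP/idP => /sub //; rewrite revK.
case: u => [//|x0 u0]; set u := x0 :: u0 => sf.
apply/squarefreeP => i k k0; rewrite size_rev => lek eq_k.
(* A square at [i] in the reversal is, read backwards, a square at [size u - (i + k.*2)] in [u]. *)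
apply: (squarefree_nth (x0 := x0) (i := size u - (i + k.*2)) sf k0); first lia.
move=> t ltk.
have := congr1 (fun v => nth x0 v (k.-1 - t)) eq_k.
rewrite !nth_take ?nth_drop; try lia.
rewrite !nth_rev; try lia.
move=> eq_nth; transitivity (nth x0 u (size u - (i + k + (k.-1 - t)).+1)).
  by congr nth; lia.
by rewrite -eq_nth; congr nth; lia.
Qed.

Lemma squarefree_take i w : squarefree w -> squarefree (take i w).
Proof.
move=> sf; rewrite -squarefree_rev.
have [le_i|/ltnW lt_i] := leqP i (size w).
  by rewrite rev_take; apply: squarefree_drop; rewrite squarefree_rev.
by rewrite take_oversize // squarefree_rev.
Qed.

End SquarefreeWords.

(** * Counting squarefree words *)

Fixpoint squarefree_words (T : finType) n : seq (seq T) :=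
  if n is n'.+1 then
    [seq w <- [seq x :: w | x <- enum T, w <- squarefree_words T n'] |
       ~~ square_prefix w]
  else [:: [::]].

Section Counting.
Variable T : finType.

Notation words := (squarefree_words T).

Lemma mem_squarefree_words n w :
  (w \in words n) = (size w == n) && squarefree w.
Proof.
elim: n w => [|n IH] [|x w] //=; rewrite mem_filter.
  by rewrite andbC; apply/negbTE; rewrite negb_and; apply/orP; left;
    apply/negP => /allpairsP[[y v] []].
rewrite andbA eqSS -andbA [RHS]andbCA; congr (_ && _).
rewrite -IH; apply/allpairsP/idP => [[[y v] /= [_ vw [_ ->]]]//|xw].
by exists (x, w); rewrite mem_enum.
Qed.

Lemma uniq_squarefree_words n : uniq (words n).
Proof.
elim: n => //= n IH; apply/filter_uniq/allpairs_uniq; rewrite ?enum_uniq //.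
by move=> [x w] [y v] _ _ /= [-> ->].
Qed.

Let extensions n := [seq x :: w | x <- enum T, w <- words n].

Lemma uniq_extensions n : uniq (extensions n).
Proof.
apply: allpairs_uniq; rewrite ?enum_uniq ?uniq_squarefree_words //.
by move=> [x w] [y v] _ _ /= [-> ->].
Qed.

(* A word that begins with two equal blocks of length [k] is determined by what
   follows the first one. *)
Lemma count_square_prefix n k : 0 < k -> k.*2 <= n.+1 ->
  count (fun w => take k w == take k (drop k w)) (extensions n)
    <= size (words (n.+1 - k)).
Proof.
move=> k0 lek; apply: (count_le_inj (f := drop k)).
- exact: uniq_extensions.
- case: k k0 lek => // k _ lek _ /allpairsP[[x v] /= [_ vn ->]] _.
  move: vn; rewrite !mem_squarefree_words => /andP[/eqP sv sf] /=.
  by rewrite size_drop sv squarefree_drop // subSS eqxx.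
- move=> w v _ _ /eqP ew /eqP ev eq_wv.
  by rewrite -(cat_take_drop k w) -(cat_take_drop k v) ew ev eq_wv.
Qed.

Lemma size_squarefree_wordsS n :
  #|T| * size (words n) <= size (words n.+1) + \sum_(i < n.+1) size (words i).
Proof.
rewrite -[#|T| * _](_ : size (extensions n) = _); last first.
  by rewrite size_allpairs cardE.
rewrite -(count_predC (@square_prefix T)) addnC size_filter leq_add2l.
rewrite (@eq_in_count _ _
  (fun w => has (fun k => take k w == take k (drop k w)) (iota 1 n.+1./2))).
  apply: leq_trans (count_has_le _ _ _) _.
  apply: (@leq_trans (\sum_(k <- iota 1 n.+1./2) size (words (n.+1 - k)))).
    rewrite big_seq [X in _ <= X]big_seq; apply: leq_sum => k.
    rewrite mem_iota => /andP[k0 lek]; apply: count_square_prefix => //; lia.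
  (* Reversing the sum matches block length [k] with the term of index [n.+1 - k]; the terms with
     [k] above the half are dropped. *)
  rewrite -(big_mkord xpredT (fun i => size (words i))) big_nat_rev /=.
  rewrite add0n (iotaDl 1 0) big_map.
  rewrite (big_cat_nat (n := n.+1./2)) //=; last lia.
  rewrite /index_iota subn0; under eq_bigr => i _ do rewrite add1n.
  exact: leq_addr.
move=> _ /allpairsP[[x v] /= [_ vn ->]].
by move: vn; rewrite mem_squarefree_words /square_prefix /= => /andP[/eqP -> _].
Qed.

Lemma size_squarefree_wordsS_le n :
  size (words n.+1) <= #|T| * size (words n).
Proof.
by rewrite size_filter (leq_trans (count_size _ _)) // size_allpairs cardE.
Qed.

Hypothesis T4 : 4 <= #|T|.

Lemma squarefree_words_double n :
  (size (words n)).*2 <= size (words n.+1).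
Proof.
(* With [S(n) = a(0) + ... + a(n)], the two bounds feed each other: [S(n) <= 2 a(n) <= a(n+1)] gives
   [S(n+1) <= 2 a(n+1)], and then [4 a(n+1) <= a(n+2) + S(n+1)] gives the next doubling. *)
suff [] : (size (words n)).*2 <= size (words n.+1) /\
          \sum_(i < n.+1) size (words i) <= (size (words n)).*2 by [].
elim: n => [|n [IH1 IH2]].
  have S1 : \sum_(i < 1) size (words i) = 1 by rewrite big_ord_recl big_ord0.
  by have := size_squarefree_wordsS 0; rewrite S1 [size (words 0)]/=; lia.
have S2 : \sum_(i < n.+2) size (words i) <= (size (words n.+1)).*2.
  rewrite big_ord_recr; move: IH1 IH2; move: (\sum_(i < n.+1) _) => S /=; lia.
split=> //; have := size_squarefree_wordsS n.+1.
move: S2; move: (\sum_(i < n.+2) _) => S; move: (size _) => a.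
move: (size _) => b; nia.
Qed.

Lemma squarefree_words_growth m n :
  2 ^ m * size (words n) <= size (words (m + n)).
Proof.
elim: m => [|m IH]; first by rewrite mul1n.
rewrite addSn expnS; apply: leq_trans (squarefree_words_double _).
by rewrite -mulnA mul2n leq_double.
Qed.

Lemma squarefree_words_gt0 n : 0 < size (words n).
Proof.
have := squarefree_words_growth n 0; rewrite addn0 muln1.
by apply: leq_trans; rewrite expn_gt0.
Qed.

End Counting.

(** * Choosing words with distinct ends *)

Definition orient (T : Type) (b : bool) (w : seq T) := if b then rev w else w.

Section DistinctEnds.
Variables (T : finType) (n : nat).
Hypothesis T4 : #|T| = 4.

Notation words := (squarefree_words T).

Definition word_end b (w : seq T) := take n.+1 (orient b w).

Lemma mem_words_orient m b w : (orient b w \in words m) = (w \in words m).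
Proof.
by case: b; rewrite // !mem_squarefree_words size_rev squarefree_rev.
Qed.

Lemma orient_inj b : injective (@orient T b).
Proof. by case: b => // u v /(congr1 rev); rewrite !revK. Qed.

(** Once one end is fixed, the other [n] letters, which form a squarefree word, determine the
    word. *)
Lemma count_word_end b f :
  count (fun w => word_end b w == f) (words n.*2.+1) <= size (words n).
Proof.
apply: (count_le_inj (f := drop n.+1 \o orient b)).
- exact: uniq_squarefree_words.
- move=> w; rewrite -(mem_words_orient _ b) !mem_squarefree_words.
  move=> /andP[/eqP sw sf] _ /=; rewrite squarefree_drop // size_drop sw andbT.
  by apply/eqP; lia.
- move=> u v _ _ /eqP eu /eqP ev /= euv; apply: (@orient_inj b).
  rewrite -(cat_take_drop n.+1 (orient b u)) -(cat_take_drop n.+1 (orient b v)).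
  by rewrite euv -/(word_end b u) -/(word_end b v) eu ev.
Qed.

(** A word of length [2n+1] whose two ends agree is a palindrome, so its first [n+1] letters
    determine it. *)
Lemma count_palindrome :
  count (fun w => word_end false w == word_end true w) (words n.*2.+1)
    <= size (words n.+1).
Proof.
apply: (count_le_inj (f := take n.+1)).
- exact: uniq_squarefree_words.
- move=> w; rewrite !mem_squarefree_words => /andP[/eqP sw sf] _.
  by rewrite squarefree_take // size_takel ?sw ?eqxx //; lia.
- move=> u v; rewrite !mem_squarefree_words /word_end /=.
  move=> /andP[/eqP su _] /andP[/eqP sv _]; rewrite !take_rev su sv.
  move=> /eqP eu /eqP ev euv.
  have en : n.*2.+1 - n.+1 = n by lia.
  have /(can_inj revK) edrop : rev (drop n u) = rev (drop n v).
    by rewrite -en -eu -ev.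
  have -> : u = take n u ++ drop n u by rewrite cat_take_drop.
  have -> : v = take n v ++ drop n v by rewrite cat_take_drop.
  have tk w : take n w = take n (take n.+1 w) by rewrite take_takel.
  by rewrite tk [take n v]tk euv edrop.
Qed.

Lemma words_with_distinct_ends K : 4 * K + 2 <= 2 ^ n ->
  exists s : seq (seq T),
    [/\ size s = K, uniq s, {subset s <= words n.*2.+1} &
        forall w w' b b', w \in s -> w' \in s ->
          word_end b w = word_end b' w' -> w = w' /\ b = b'].
Proof.
elim: K => [_|K IH leK]; first by exists [::].
have [|s [ss us sub inj]] := IH; first lia.
(* [F] lists the ends already taken. A new word must avoid them at both of its ends, and these must
   differ from each other. *)
pose F := [seq word_end b w | w <- s, b <- [:: false; true]].
have sF : size F = 2 * K by rewrite size_allpairs ss mulnC.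
pose hits b w := has (fun f => word_end b w == f) F.
pose pal w := word_end false w == word_end true w.
pose bad := predU (hits false) (predU (hits true) pal).
have [bad_all|] := boolP (all bad (words n.*2.+1)); last first.
  rewrite -has_predC => /hasP[w wn]; rewrite /= !negb_or.
  case/and3P=> nF nT nP; exists (w :: s).
  have wF b u c : u \in s -> word_end b w <> word_end c u.
    move=> us' eq_wu; have uF : word_end c u \in F.
      by apply/allpairsP; exists (u, c); split => //; case: c {eq_wu}.
    case: b eq_wu => eq_wu; [move/hasPn: nT|move/hasPn: nF] => /(_ _ uF);
      by rewrite eq_wu eqxx.
  split=> /=; first by rewrite ss.
  - by rewrite us andbT; apply/negP => /(wF false w false); apply.
  - by move=> u; rewrite inE => /predU1P[->//|/sub].
  - move=> u v b c; rewrite !inE => /predU1P[->|uin] /predU1P[->|vin].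
    + by case: b c => -[] // e; move: nP; rewrite /pal e eqxx.
    + by move/wF => /(_ vin).
    + by move/esym/wF => /(_ uin).
    + exact: inj.
have hitsP b : count (hits b) (words n.*2.+1) <= 2 * K * size (words n).
  apply: leq_trans (count_has_le _ _ _) _.
  apply: leq_trans (leq_sum _ (fun f _ => count_word_end b f)) _.
  by rewrite big_const_seq count_predT iter_addn_0 sF mulnC.
(* If all words were bad, then [2^(n+1) a(n) <= a(2n+1) <= 4K a(n) + a(n+1) <= (4K + 4) a(n)],
   whereas [leK] says [4K + 6 <= 2^n]. *)
have := all_count bad (words n.*2.+1); rewrite bad_all => /esym/eqP cnt.
have le_bad :
    count bad (words n.*2.+1) <= 4 * K * size (words n) + size (words n.+1).
  have := count_predUI (hits false) (predU (hits true) pal) (words n.*2.+1).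
  have := count_predUI (hits true) pal (words n.*2.+1).
  have := hitsP true; have := hitsP false; have := count_palindrome.
  rewrite -/bad -/pal; lia.
have le_ext := size_squarefree_wordsS_le T n.
have := squarefree_words_growth (T := T) _ n.+1 n; rewrite T4 => /(_ isT).
have -> : n.+1 + n = n.*2.+1 by lia.
have := squarefree_words_gt0 (T := T) _ n; rewrite T4 => /(_ isT).
move: cnt le_bad le_ext leK; rewrite T4 expnS => ->; nia.
Qed.

End DistinctEnds.

(** * Paths in subdivisions *)

Lemma repetitively_coloured_rev (G : sgraph) (C : Type) (phi : G -> C) s :
  repetitively_coloured phi s -> repetitively_coloured phi (rev s).
Proof.
case=> k [k0 ss rep]; exists k; split; rewrite ?size_rev // => x0 i ltik.
rewrite !nth_rev; try lia.
have := rep x0 (k.-1 - i) _; rewrite ss => e.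
transitivity (phi (nth x0 s (k + (k.-1 - i)))).
  by congr (phi (nth _ _ _)); lia.
by rewrite -e; [congr (phi (nth _ _ _)); lia | lia].
Qed.

Lemma is_path_rev (G : sgraph) (s : seq G) : is_path (rev s) = is_path s.
Proof.
rewrite /is_path rev_uniq rev_sorted; congr (_ && _).
by apply: eq_sorted => x y; rewrite adj_sym.
Qed.

Section SubdividedEdges.
Variables (G : sgraph) (d : nat).

Notation H := (subdivision G d).
Notation edge := (oriented_edge G).

Definition source (q : edge) b := if b then (val q).2 else (val q).1.

Lemma adj_source q b : adj (source q b) (source q (~~ b)).
Proof. by have /andP[uv _] := valP q; case: b; rewrite //= adj_sym. Qed.

(** [insub] succeeds at positions [1] to [d], the division vertices; its failure at [d.+1] supplies
    the far end. *)
Definition subdivided_edge (q : edge) k : H :=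
  if k is k'.+1 then
    if insub k' is Some i then inr (q, i) else inl (val q).2
  else inl (val q).1.

(* The [k]-th vertex, for [k <= d.+1], of the path replacing [q], followed
   backwards if [b]. *)
Definition along q b k : H := subdivided_edge q (if b then d.+1 - k else k).

Lemma along0 q b : along q b 0 = inl (source q b).
Proof. by case: b => //=; rewrite /along /= insubF // ltnn. Qed.

Lemma along_negb q b k : k <= d.+1 -> along q (~~ b) k = along q b (d.+1 - k).
Proof. by rewrite /along => lek; case: b => //=; rewrite subKn. Qed.

Lemma along_last q b : along q b d.+1 = inl (source q (~~ b)).
Proof. by rewrite -along0 along_negb ?subn0. Qed.

Definition is_original (x : H) := if x is inl _ then true else false.

Lemma subdivided_edge_inner q k (lt_kd : k < d) :
  subdivided_edge q k.+1 = inr (q, Ordinal lt_kd).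
Proof. by rewrite /= insubT. Qed.

Lemma along_inner q b k : 0 < k -> k <= d -> ~~ is_original (along q b k).
Proof.
move=> k0 lek; rewrite /along; case: b.
  case E : (d.+1 - k) => [|j]; first lia.
  have lt_jd : j < d by lia.
  by rewrite subdivided_edge_inner.
by case: k k0 lek => // k _ lt_kd; rewrite subdivided_edge_inner.
Qed.

Lemma adj_subdivided_edge q k x : 0 < k -> k <= d ->
  adj (subdivided_edge q k : H) x ->
  x = subdivided_edge q k.-1 \/ x = subdivided_edge q k.+1.
Proof.
case: k => // k _ lt_kd; rewrite subdivided_edge_inner.
case: x => [v|[r i]] /=.
  rewrite /subdiv_end /= => /orP[/andP[/eqP -> /eqP ->]|/andP[/eqP-> /eqP ekd]].
    by left.
  by right; rewrite ekd insubF // ltnn.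
case/andP=> /eqP <- /orP[]/eqP eki; [right | left].
  by rewrite eki insubT // => lt_id; congr (inr (_, _)); apply: val_inj.
by rewrite -eki /= insubT // => lt_id; congr (inr (_, _)); apply: val_inj.
Qed.

Lemma adj_along q b k x : 0 < k -> k <= d -> adj (along q b k) x ->
  x = along q b k.-1 \/ x = along q b k.+1.
Proof.
move=> k0 lek; rewrite /along; case: b; last exact: adj_subdivided_edge.
move=> /adj_subdivided_edge[||->|->]; try lia; [right|left].
  by congr subdivided_edge; lia.
by congr subdivided_edge; lia.
Qed.

Lemma adj_original v (x : H) : 0 < d -> adj (inl v : H) x ->
  exists q b, [/\ v = source q b & x = along q b 1].
Proof.
move=> d0; case: x => [u|[q i]] /=; first by rewrite eqn0Ngt d0.
rewrite /subdiv_end /= => /orP[]/andP[/eqP -> /eqP ei]; exists q.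
  exists false; split=> //; rewrite /along subdivided_edge_inner.
  by congr (inr (_, _)); apply: val_inj.
exists true; split=> //; rewrite /along subn1 /= -[X in subdivided_edge _ X]ei.
rewrite (subdivided_edge_inner _ (ltn_ord i)); congr (inr (_, _)).
exact: val_inj.
Qed.

Lemma adj_inner (y x : H) : ~~ is_original y -> adj y x ->
  exists q b k, [/\ 0 < k <= d, y = along q b k & x = along q b k.+1].
Proof.
case: y => // -[q i] _ yx.
have yE : (inr (q, i) : H) = along q false i.+1.
  rewrite /along (subdivided_edge_inner _ (ltn_ord i)).
  by congr (inr (_, _)); apply: val_inj.
have lt_id := ltn_ord i.
have : adj (along q false i.+1) x by rewrite -yE.
case/adj_along => // -> /=; last by exists q, false, i.+1.
(* Position [i.+1] forwards is [d - i] backwards, so a step back along [q] is a step onward in the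
   other direction. *)
exists q, true, (d - i); split; first lia.
  by rewrite yE -[true]/(~~ false) along_negb; [congr along; lia | lia].
by rewrite -[true]/(~~ false) along_negb; [congr along; lia | lia].
Qed.

Section Path.
Variables (P : seq H) (x0 : H).
Hypothesis pathP : is_path P.

Notation p i := (nth x0 P i).

Lemma path_adj i : i.+1 < size P -> adj (p i) (p i.+1).
Proof. by case/andP: pathP => _ /sortedP/(_ i)/[apply]. Qed.

(** A division vertex has only two neighbours, and the path, having just come from one, must leave
    by the other. *)
Lemma path_follows q b k i :
  (p i) = along q b k -> (p i.+1) = along q b k.+1 ->
  forall j, k + j <= d.+1 -> i + j < size P -> (p (i + j)) = along q b (k + j).
Proof.
move=> Pi Pi1; elim/ltn_ind => -[|[|j]] IH lej ltj; rewrite ?addn0 ?addn1 //.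
have IH1 := IH j.+1 (ltnSn _) ltac:(lia) ltac:(lia).
have IH2 := IH j (ltnW (ltnSn _)) ltac:(lia) ltac:(lia).
have := @path_adj (i + j.+1); rewrite -addnS IH1 => /(_ ltj).
case/adj_along; try lia; last by rewrite -addnS.
rewrite [k + _]addnS /= -IH2 => /eqP; case/andP: pathP => uP _.
rewrite nth_uniq //; first by move/eqP=> e; exfalso; lia.
by apply: leq_ltn_trans ltj; lia.
Qed.

Hypothesis d0 : 0 < d.

Lemma path_from_original i v : (p i) = inl v -> i.+1 < size P ->
  exists q b, v = source q b /\
    forall j, j <= d.+1 -> i + j < size P -> (p (i + j)) = along q b j.
Proof.
move=> Pi lti; have := path_adj lti.
rewrite Pi => /(adj_original d0)[q [b [ev Pi1]]].
exists q, b; split=> // j lej ltj.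
by apply: (@path_follows q b 0) => //; rewrite Pi along0 ev.
Qed.

Lemma path_next_original i : is_original (p i) -> i + d.+1 < size P ->
  is_original (p (i + d.+1)).
Proof.
case Pi: (p i) => [v|//] _ lti.
have [|q [b [_ Pij]]] := path_from_original Pi; first lia.
by rewrite Pij // along_last.
Qed.

Lemma path_original_add i t : is_original (p i) -> i + t * d.+1 < size P ->
  is_original (p (i + t * d.+1)).
Proof.
move=> Pi; elim: t => [|t IH] lt; first by rewrite addn0.
by rewrite mulSnr addnA; apply: path_next_original; [apply: IH|]; lia.
Qed.

(** After an original vertex come [d] division vertices, then an original one; the induction jumps
    [d.+1] steps at a time. *)
Lemma path_original_dvd i j : is_original (p i) -> is_original (p (i + j)) ->
  i + j < size P -> d.+1 %| j.
Proof.
elim/ltn_ind: j i => j IH i Pi Pj ltj.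
have [ltd|led] := ltnP j d.+1.
  case: j => // j in IH Pj ltj ltd *.
  case Ev: (p i) Pi => [v|//] _.
  have [|q [b [_ Pij]]] := path_from_original Ev; first lia.
  move: Pj; rewrite Pij ?(ltnW ltd) //.
  by apply: contraLR => _; apply: along_inner.
have -> : j = d.+1 + (j - d.+1) by lia.
rewrite dvdn_addr //; apply: (IH _ _ (i + d.+1)); try lia.
  by apply: path_next_original => //; lia.
by rewrite -addnA subnKC.
Qed.

End Path.

End SubdividedEdges.

(** * Colouring the subdivision *)

Section Colouring.
Variables (G : sgraph) (n c : nat) (phi : G -> 'I_c).
Variable W : 'I_c -> 'I_c -> seq 'I_4.
Hypothesis phiP : nonrepetitive phi.
Hypothesis sizeW : forall a a', size (W a a') = n.*2.+1.
Hypothesis squarefreeW : forall a a', squarefree (W a a').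
Hypothesis endW : forall a1 a2 a3 a4 b b',
  word_end n b (W a1 a2) = word_end n b' (W a3 a4) ->
  [/\ a1 = a3, a2 = a4 & b = b'].

Let d := n.*2.+1.
Let d_gt0 : 0 < d := ltn0Sn _.
Notation H := (subdivision G d).

Definition edge_word (q : oriented_edge G) := W (phi (val q).1) (phi (val q).2).

(** [ord_max] is reserved for the original vertices; [lift ord_max] embeds the four letters into the
    other colours. *)
Definition subdivision_colour (x : H) : 'I_5 :=
  if x is inr (q, i) then lift ord_max (nth ord0 (edge_word q) i) else ord_max.

Notation chi := subdivision_colour.

Lemma colour_original x : (chi x == ord_max) = is_original x.
Proof.
case: x => [v|[q i]] /=; first by rewrite eqxx.
by rewrite eq_sym (negbTE (neq_lift _ _)).
Qed.

Lemma colour_along q b k : k < d ->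
  chi (along d q b k.+1) = lift ord_max (nth ord0 (orient b (edge_word q)) k).
Proof.
move=> lt_kd; rewrite /along; case: b => /=; last by rewrite insubT.
rewrite nth_rev ?sizeW // subSS.
case E: (d - k) => [|j]; first lia.
have lt_jd : j < d by lia.
by rewrite subdivided_edge_inner /= subnS -/d E.
Qed.

Lemma size_orient (T : Type) b (w : seq T) : size (orient b w) = size w.
Proof. by case: b => //=; rewrite size_rev. Qed.

(** The path runs along a single edge, so its colours spell a factor of the edge word or of its
    reversal. *)
Lemma no_repetition_inside_edge (P : seq H) : is_path P ->
  (forall x, x \in P -> ~~ is_original x) -> ~ repetitively_coloured chi P.
Proof.
move=> pathP inner [s [s0 sP rep]].
have x0 : H by case: P sP {pathP inner rep} => //= /eqP; lia.
have Pin i : i < size P -> ~~ is_original (nth x0 P i).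
  by move=> lti; apply/inner/mem_nth.
have lt1P : 1 < size P by lia.
have [q [b [k [/andP[k0 lek] P0 P1]]]] :=
  adj_inner (Pin 0 (ltnW lt1P)) (path_adj x0 pathP lt1P).
have Pi := path_follows pathP P0 P1.
(* A longer path would reach the original vertex at position [d.+1] of the edge. *)
have lt_size : k + size P <= d.+1.
  rewrite leqNgt; apply/negP => lt_d.
  have : is_original (nth x0 P (0 + (d.+1 - k))).
    by rewrite Pi ?subnKC ?along_last //; lia.
  by apply/negP/Pin; lia.
(* Position [k] on the edge carries letter [k.-1]. *)
apply: (@squarefree_nth _ ord0 (orient b (edge_word q)) k.-1 s _ s0).
- by case: (b); rewrite /= ?squarefree_rev; apply: squarefreeW.
- by rewrite size_orient sizeW -/d; lia.
move=> t lt_ts; apply: (@lift_inj _ ord_max); rewrite -!colour_along; try lia.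
have := rep x0 t lt_ts; rewrite -[t in LHS]add0n -[s + t]add0n !Pi; try lia.
have -> : k.-1 + t = (k + t).-1 by lia.
have -> : k.-1 + s + t = (k + (s + t)).-1 by lia.
by rewrite !prednK //; lia.
Qed.

(** Original vertices have their own colour, so they recur with period [s]; for the first one, at
    [j], the vertex at [s + j] is original too, and [d.+1] divides [s]. *)
Lemma repetition_period (P : seq H) (x0 : H) s : is_path P ->
  0 < s -> size P = 2 * s ->
  (forall i, i < s -> chi (nth x0 P i) = chi (nth x0 P (s + i))) ->
  has (@is_original G d) P ->
  exists j m, [/\ j <= d, 0 < m, s = m * d.+1 & is_original (nth x0 P j)].
Proof.
move=> pathP s0 sP rep hasP.
have per i : i < s -> is_original (nth x0 P (s + i)) = is_original (nth x0 P i).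
  by move=> lti; rewrite -!colour_original (rep i lti).
set j := find (@is_original G d) P.
have ltj : j < size P by rewrite -has_find.
have Pj : is_original (nth x0 P j) by apply: nth_find.
have lt_js : j < s.
  rewrite ltnNge; apply/negP => le_sj.
  have : is_original (nth x0 P (j - s)) by rewrite -per ?subnKC //; lia.
  by apply/negP; rewrite before_find // /j; lia.
have := path_original_dvd pathP d_gt0 Pj (j := s).
rewrite addnC per // => /(_ Pj ltac:(lia)).
case/dvdnP=> m es; exists j, m; split => //; last by case: m es; lia.
(* If [j > d], the original vertex at [j + m.-1 * d.+1 = s + (j - d.+1)] yields, by periodicity, one
   at [j - d.+1], before the first. *)
rewrite leqNgt; apply/negP => lt_dj.
have m0 : 0 < m by case: m es; lia.
have : is_original (nth x0 P (j - d.+1)).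
  rewrite -per; last lia.
  have -> : s + (j - d.+1) = j + m.-1 * d.+1 by nia.
  by apply: path_original_add => //; nia.
by apply/negP; rewrite before_find // /j; lia.
Qed.

(** Since [j <= n], at least [d - j >= n.+1] vertices follow the last original one, so each original
    vertex is followed by a full [word_end]. *)
Lemma no_repetition_early_original (P : seq H) (x0 : H) j m : is_path P ->
  j <= n -> 0 < m -> size P = 2 * (m * d.+1) ->
  is_original (nth x0 P j) ->
  ~ (forall i, i < m * d.+1 ->
       chi (nth x0 P i) = chi (nth x0 P (m * d.+1 + i))).
Proof.
move=> pathP lejn m0 sP Pj rep.
have ltd : n.*2.+1 = d by [].
pose pos t := j + t * d.+1.
have ltpos t : t < 2 * m -> pos t + n.+1 < size P.
  by rewrite /pos sP => ltt; nia.
have Ppos t : t < 2 * m -> is_original (nth x0 P (pos t)).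
  move=> ltt; apply: path_original_add => //.
  by have := ltpos t ltt; rewrite /pos; lia.
case E0: (nth x0 P j) Pj => [v0|//] _.
pose v t := if nth x0 P (pos t) is inl u then u else v0.
have Pv t : t < 2 * m -> nth x0 P (pos t) = inl (v t).
  by move=> /Ppos; rewrite /v; case: (nth x0 P _).
have next t : t < 2 * m -> exists q b, v t = source q b /\
    forall k, k <= d.+1 -> pos t + k < size P ->
      nth x0 P (pos t + k) = along d q b k.
  move=> ltt; apply: (path_from_original (d := d)) => //; first exact: Pv.
  by have := ltpos t ltt; lia.
apply: (phiP (s := mkseq v (2 * m))); last first.
  exists m; split=> //; first by rewrite size_mkseq.
  move=> y0 t lttm; rewrite !nth_mkseq; try lia.
  have [|q [b [-> Pq]]] := next t; first lia.
  have [|q' [b' [-> Pq']]] := next (m + t); first lia.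
  (* Equal ends give the same pair of colours and the same direction, hence sources of the same
     colour. *)
  suff /endW[e1 e2 <-] :
      word_end n b (edge_word q) = word_end n b' (edge_word q').
    by rewrite /source; case: (b).
  apply: (@eq_from_nth _ ord0);
    rewrite !size_takel ?size_orient ?sizeW; try lia.
  move=> k ltk; rewrite !nth_take //; apply: (@lift_inj _ ord_max).
  rewrite -!colour_along; try lia.
  have lt1 := ltpos t ltac:(lia); have lt2 := ltpos (m + t) ltac:(lia).
  rewrite -Pq; try lia.
  rewrite -Pq'; try lia.
  rewrite rep; last by rewrite /pos; nia.
  by congr (chi (nth _ _ _)); rewrite /pos; nia.
apply/andP; split.
  rewrite map_inj_in_uniq ?iota_uniq // => t t'.
  rewrite !mem_iota /= !add0n => ltt ltt' evt.
  have lt1 := ltpos t ltt; have lt2 := ltpos t' ltt'.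
  have /eqP : nth x0 P (pos t) = nth x0 P (pos t') by rewrite !Pv // evt.
  case/andP: pathP => uP _; rewrite nth_uniq //.
  - by rewrite /pos eqn_add2l eqn_pmul2r // => /eqP.
  - exact: leq_ltn_trans (leq_addr _ _) lt1.
  - exact: leq_ltn_trans (leq_addr _ _) lt2.
apply/(sortedP v0) => t; rewrite size_mkseq => ltt.
rewrite !nth_mkseq; try lia.
have [|q [b [-> Pq]]] := next t; first lia.
have epos : pos t + d.+1 = pos t.+1 by rewrite /pos; lia.
(* Consecutive original vertices are the two ends of the edge followed between them. *)
have [->] : inl (v t.+1) = inl (source q (~~ b)) :> H; last exact: adj_source.
rewrite -Pv // -epos Pq ?along_last // epos.
exact: leq_ltn_trans (leq_addr _ _) (ltpos _ ltt).
Qed.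

Lemma subdivision_nonrepetitive : nonrepetitive chi.
Proof.
move=> P pathP repP.
have [hasP|/hasPn] := boolP (has (@is_original G d) P); last first.
  by move=> inner; apply: (no_repetition_inside_edge pathP inner repP).
have [s [s0 sP rep]] := repP.
have x0 : H by case: P sP {pathP repP hasP rep} => //= /eqP; lia.
have [j [m [lejd m0 es Pj]]] := repetition_period pathP s0 sP (rep x0) hasP.
have [lejn|ltnj] := leqP j n.
  by apply: (no_repetition_early_original pathP lejn m0 _ Pj);
    rewrite -es //; apply: rep.
(* Reversing the path moves its last original vertex, at [j + (2 * m).-1 * d.+1], to position
   [d - j], which is at most [n] since [j > n]. *)
have [s' [s'0 sP' rep']] := repetitively_coloured_rev repP.
have es' : s' = s by move: sP'; rewrite size_rev; lia.
have sz : size P = 2 * (m * d.+1) by rewrite sP es.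
apply: (@no_repetition_early_original (rev P) x0 (d - j) m);
  rewrite ?is_path_rev ?size_rev //.
- by rewrite /d; lia.
- rewrite nth_rev; last nia.
  have -> : size P - (d - j).+1 = j + (2 * m).-1 * d.+1 by nia.
  by apply: path_original_add => //; nia.
- by move=> i lti; rewrite -es -es'; apply: rep'; rewrite es' es.
Qed.

End Colouring.

(** * The nonrepetitive chromatic number of the subdivision *)

Lemma nonrep_numberP (G : sgraph) :
  nonrepetitively_colourable G (nonrep_number G).
Proof. by rewrite /nonrep_number; case: ex_minnP => c /asboolP. Qed.

Lemma nonrep_number_le (G : sgraph) c : nonrepetitively_colourable G c ->
  nonrep_number G <= c.
Proof.
by rewrite /nonrep_number => cG; case: ex_minnP => m _; apply; apply/asboolP.
Qed.

Lemma nonrepetitive_adj (G : sgraph) (C : Type) (phi : G -> C) u v :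
  nonrepetitive phi -> adj u v -> phi u <> phi v.
Proof.
move=> phiP uv e; apply: (phiP [:: u; v]).
  rewrite /is_path /= uv inE !andbT; apply/eqP => euv.
  by move: uv; rewrite euv adj_irr.
by exists 1; split=> // x0 [|i].
Qed.

Lemma edgeless_colourable (G : sgraph) c : 0 < c ->
  (forall u v : G, adj u v = false) -> nonrepetitively_colourable G c.
Proof.
case: c => // c _ noadj; exists (fun=> ord0) => -[|x [|y s]].
- by move=> _ [k [k0 /= e _]]; lia.
- by move=> _ [k [k0 /= e _]]; lia.
- by rewrite /is_path /= noadj andbF.
Qed.

Lemma expn_le_of_log2 (R : realType) c n : 0 < c ->
  (17 * log2 (c%:R : R) <= n%:R)%R -> c ^ 17 <= 2 ^ n.
Proof.
move=> c0; rewrite /log2 => le_n.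
have ln2 : (0 < ln (2 : R))%R by apply: ln_gt0; rewrite ltr1n.
rewrite -(ler_nat R) !natrX -ler_ln ?posrE ?exprn_gt0 ?ltr0n //.
rewrite !lnXn ?ltr0n // -[(ln c%:R *+ 17)%R]mulr_natl.
by rewrite -[(ln 2 *+ n)%R]mulr_natl -ler_pdivrMr // -mulrA.
Qed.

Theorem theorem91 (R : realType) (G : sgraph) (d : nat)
    (hd : (d%:Z = 2 * Num.ceil (17 * log2 ((nonrep_number G)%:R : R)) + 1)%R) :
  nonrep_number (subdivision G d) <= 5.
Proof.
apply: nonrep_number_le.
have [phi phiP] := nonrep_numberP G.
set c := nonrep_number G in hd phi phiP *.
set z := Num.ceil _ in hd.
(* [z] is nonnegative because [2z + 1] is the natural number [d]. *)
have [n ez ed] : exists2 n : nat, z = (n%:Z)%R & d = n.*2.+1.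
  exists `|z|%N; lia.
(* With at most one colour, adjacent vertices would share it; so [G] has no edge, and neither has
   its subdivision. *)
have [c1|c2] := leqP c 1.
  apply: edgeless_colourable => //.
  have noedge (u v : G) : adj u v = false.
    apply/negP => uv; apply: (nonrepetitive_adj phiP uv); apply: val_inj.
    by have := ltn_ord (phi u); have := ltn_ord (phi v) => /=; lia.
  have noq (q : oriented_edge G) : False.
    by have := valP q; rewrite /= noedge.
  move=> [u|[q i]]; last by case: (noq q).
  by move=> [v|[q i]] /=; [rewrite noedge andbF | case: (noq q)].
subst d.
have lec : c ^ 17 <= 2 ^ n.
  apply: (@expn_le_of_log2 R); first lia.
  have := ceil_ge (17 * log2 (c%:R : R))%R.
  by rewrite -/z ez.
have [|s [ss us sub inj]] :=
  @words_with_distinct_ends 'I_4 n (card_ord 4) (c * c).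
  (* For [c >= 2], [4c^2 + 2 <= 8c^2 <= c^5 <= c^17]. *)
  apply: leq_trans lec; apply: (@leq_trans (c * c * c ^ 3)).
    have : 2 ^ 3 <= c ^ 3 by rewrite leq_exp2r.
    by move: (c ^ 3) => C; nia.
  by rewrite mulnn -expnD leq_exp2l.
(* The [c * c] words are indexed by the pairs of colours, so the default [[::]] is never reached. *)
pose W (a b : 'I_c) := nth [::] s (enum_rank (a, b)).
have lt_rank (p : 'I_c * 'I_c) : enum_rank p < size s.
  have cardp : #|{: 'I_c * 'I_c}| = c * c by rewrite card_prod card_ord.
  by rewrite ss -cardp ltn_ord.
have Ws a b : W a b \in s by apply: mem_nth.
have Ww a b : (size (W a b) == n.*2.+1) && squarefree (W a b).
  by rewrite -mem_squarefree_words; apply/sub/Ws.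
exists (@subdivision_colour G n c phi W).
apply: subdivision_nonrepetitive => //.
- by move=> a b; have /andP[/eqP] := Ww a b.
- by move=> a b; have /andP[] := Ww a b.
- move=> a1 a2 a3 a4 b b' /inj[]// /eqP.
  by rewrite nth_uniq // => /eqP/val_inj/enum_rank_inj[-> ->].
Qed.
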